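(* Let $n\ge1$ and let the coefficients $\phi_r^{Sp(2n)}(a_0,1)$, $\phi_r^{SO(2n+1)}(a_0,1)$, $\psi_{q,r}^{Sp(2n)}(a_0,a_1,1)$, $\psi_{q,r}^{SO(2n+1)}(a_0,a_1,1)$ of the non-spin expansions, and the coefficients $\phi_r^{SO(2n+1),\mathrm{spin}}(a_{1/2},1)$, $\phi_r^{O(2n),\mathrm{spin}}(a_{1/2},1)$, $\psi_{q,r}^{SO(2n+1),\mathrm{spin}}(a_{1/2},a_{3/2},1)$, $\psi_{q,r}^{O(2n),\mathrm{spin}}(a_{1/2},a_{3/2},1)$ of the spin expansions, be defined as in the context. Then for all scalars $a_{1/2},a_{3/2}$, \begin{align*} \phi_r^{SO(2n+1),\mathrm{spin}}(a_{1/2},1)&=\phi_r^{Sp(2n)}(a_{1/2}-1,1),\\ \phi_r^{O(2n),\mathrm{spin}}(a_{1/2},1)&=(-1)^r\,\phi_r^{SO(2n+1)}(-a_{1/2}+1,1),\\ \psi_{q,r}^{SO(2n+1),\mathrm{spin}}(a_{1/2},a_{3/2},1)&=\psi_{q,r}^{Sp(2n)}(a_{1/2}-a_{3/2}+1,\ a_{3/2}-1,\ 1),\\ \psi_{q,r}^{O(2n),\mathrm{spin}}(a_{1/2},a_{3/2},1)&=(-1)^q\,\psi_{q,r}^{SO(2n+1)}(a_{1/2}-a_{3/2}+1,\ -a_{3/2}+1,\ 1), \end{align*} for all $0\le r\le n$ in the first two identities and all $q,r\ge0$ with $q+r\le n$ in the last two.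
   Context: $\mathbf{x}=(x_1,\dots,x_n)$ are indeterminates (with formal square roots), $\overline{x}_i=x_i^{-1}$, $\overline{\mathbf{x}}=(\overline{x}_1,\dots,\overline{x}_n)$. $\mathrm{ch}^G_\lambda$ is the irreducible character of highest weight $\lambda$ evaluated on elements with eigenvalues $(\mathbf{x},\overline{\mathbf{x}})$ for $G=Sp(2n)$, $O(2n)$ and $(\mathbf{x},\overline{\mathbf{x}},1)$ for $G=SO(2n+1)$; weights with half-odd-integer components denote spin characters (characters of the spin covering group, given by Weyl's character formula). For a weight $\lambda$ with all components positive half-odd-integers, $\mathrm{ch}^{O(2n)}_\lambda=\mathrm{ch}^{SO(2n)}_{\lambda_+}+\mathrm{ch}^{SO(2n)}_{\lambda_-}$ with $\lambda_\pm=(\lambda_1,\dots,\lambda_{n-1},\pm\lambda_n)$. Exponents in weights denote repeated components. Non-spin coefficients, for $G=Sp(2n)$ or $SO(2n+1)$, are defined by the (unique) expansions $$\prod_{i=1}^n(a_0+x_i+\overline{x}_i)=\sum_{q+r=n}\phi_r^G(a_0,1)\,\mathrm{ch}^G_{(1^q,0^r)},$$ $$\prod_{i=1}^n\bigl(a_0+a_1(x_i+\overline{x}_i)+(x_i^2+\overline{x}_i^2)\bigr)=\sum_{p+q+r=n}\psi_{q,r}^G(a_0,a_1,1)\,\mathrm{ch}^G_{(2^p,1^q,0^r)} .$$ Spin coefficients, for $G=SO(2n+1)$ or $O(2n)$, are defined by the (unique) expansions $$\prod_{i=1}^n\bigl(a_{1/2}(x_i^{1/2}+x_i^{-1/2})+(x_i^{3/2}+x_i^{-3/2})\bigr)=\sum_{q+r=n}\phi_r^{G,\mathrm{spin}}(a_{1/2},1)\,\mathrm{ch}^G_{((3/2)^q,(1/2)^r)},$$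 $$\prod_{i=1}^n\bigl(a_{1/2}(x_i^{1/2}+x_i^{-1/2})+a_{3/2}(x_i^{3/2}+x_i^{-3/2})+(x_i^{5/2}+x_i^{-5/2})\bigr)=\sum_{p+q+r=n}\psi_{q,r}^{G,\mathrm{spin}}(a_{1/2},a_{3/2},1)\,\mathrm{ch}^G_{((5/2)^p,(3/2)^q,(1/2)^r)} .$$ All sums are over nonnegative integers. *)

(* Defs.v *)
From HB Require Import structures.
From mathcomp Require Import all_boot all_order all_fingroup all_algebra.
From mathcomp Require Export fraction.
From mathcomp Require Export mpoly.

Set Implicit Arguments.
Unset Strict Implicit.
Unset Printing Implicit Defensive.

Import GRing.Theory.

Local Open Scope ring_scope.

(* The field F(t_1, ..., t_n), where t_i is the formal square root of the     *)
(* indeterminate x_i.                                                         *)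
Definition xfield (F : fieldType) (n : nat) : fieldType :=
  {fraction {mpoly F[n]}}.

Definition scal (F : fieldType) (n : nat) (a : F) : xfield F n :=
  FracField.tofrac (mpolyC n a).

(* xpow i m is x_i^(m/2).                                                     *)
Definition xpow (F : fieldType) (n : nat) (i : 'I_n) (m : int) : xfield F n :=
  (FracField.tofrac ('X_i : {mpoly F[n]}) : xfield F n) ^ m.

(* xsym i m is x_i^(m/2) + x_i^(-m/2).                                        *)
Definition xsym (F : fieldType) (n : nat) (i : 'I_n) (m : int) : xfield F n :=
  xpow F i m + xpow F i (- m).

(* Weights are given in doubled coordinates, so that they are integral: mu    *)
(* stands for the weight mu/2, and dominant weights lambda are sequences of   *)
(* length n.                                                                  *)

(* A pair (s, e) is the signed permutation w acting on weights by             *)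
(* (w mu)_i = (-1)^(e i) mu_(s i), of determinant (-1)^s * prod_i (-1)^(e i). *)
(* These are the elements of the Weyl group of types B_n and C_n; those with  *)
(* an even number of sign changes form the Weyl group of type D_n.            *)
Definition signs_BC (n : nat) : pred {ffun 'I_n -> bool} := predT.
Definition signs_D (n : nat) : pred {ffun 'I_n -> bool} :=
  [pred e : {ffun 'I_n -> bool} | ~~ odd #|[set i | e i]|].

(* sum_(w in W) det(w) x^(w mu)                                               *)
Definition alternant (F : fieldType) (n : nat)
    (W : pred {ffun 'I_n -> bool}) (mu : 'I_n -> int) : xfield F n :=
  \sum_(s : 'S_n) \sum_(e : {ffun 'I_n -> bool} | W e)
    (-1) ^+ s * (\prod_(i < n) (-1) ^+ e i) *
    \prod_(i < n) xpow F i ((-1) ^+ e i * mu (s i)).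

(* Weyl's character formula, rho being half the sum of the positive roots.    *)
Definition weyl_char (F : fieldType) (n : nat)
    (W : pred {ffun 'I_n -> bool}) (rho : 'I_n -> int) (lambda : seq int) :
    xfield F n :=
  alternant F W (fun i => nth 0 lambda i + rho i) / alternant F W rho.

(* With 0-based indices, the undoubled rho_i is n - i for Sp(2n),             *)
(* n - i - 1/2 for SO(2n+1) and n - i - 1 for SO(2n).                         *)
Definition rho_Sp (n : nat) (i : 'I_n) : int := 2 * (n%:Z - i%:Z).
Definition rho_SOodd (n : nat) (i : 'I_n) : int := 2 * (n%:Z - i%:Z) - 1.
Definition rho_SOeven (n : nat) (i : 'I_n) : int := 2 * (n%:Z - i%:Z - 1).

Definition ch_Sp (F : fieldType) (n : nat) : seq int -> xfield F n :=
  weyl_char F (@signs_BC n) (@rho_Sp n).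
Definition ch_SOodd (F : fieldType) (n : nat) : seq int -> xfield F n :=
  weyl_char F (@signs_BC n) (@rho_SOodd n).
Definition ch_SOeven (F : fieldType) (n : nat) : seq int -> xfield F n :=
  weyl_char F (@signs_D n) (@rho_SOeven n).

Definition neg_last (n : nat) (lambda : seq int) : seq int :=
  set_nth 0 lambda n.-1 (- nth 0 lambda n.-1).

(* The O(2n) character for weights all of whose components are positive       *)
(* half-odd-integers.                                                         *)
Definition ch_O_spin (F : fieldType) (n : nat) (lambda : seq int) :
    xfield F n :=
  ch_SOeven F n lambda + ch_SOeven F n (neg_last n lambda).

(* The expansions defining the coefficients phi r (for r <= n) and psi q r    *)
(* (for q + r <= n), with respect to a family ch of characters; the last      *)
(* coefficient of each factor on the left is 1.                               *)
Definition phi_expansion (F : fieldType) (n : nat) (ch : seq int -> xfield F n)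
    (a0 : F) (phi : nat -> F) : Prop :=
  \prod_(i < n) (scal n a0 + xsym F i 2) =
  \sum_(q < n.+1) \sum_(r < n.+1 | (q + r == n)%N)
    scal n (phi r) * ch (nseq q 2 ++ nseq r 0).

Definition psi_expansion (F : fieldType) (n : nat) (ch : seq int -> xfield F n)
    (a0 a1 : F) (psi : nat -> nat -> F) : Prop :=
  \prod_(i < n) (scal n a0 + scal n a1 * xsym F i 2 + xsym F i 4) =
  \sum_(p < n.+1) \sum_(q < n.+1) \sum_(r < n.+1 | (p + q + r == n)%N)
    scal n (psi q r) * ch (nseq p 4 ++ nseq q 2 ++ nseq r 0).

Definition phi_spin_expansion (F : fieldType) (n : nat)
    (ch : seq int -> xfield F n) (a12 : F) (phi : nat -> F) : Prop :=
  \prod_(i < n) (scal n a12 * xsym F i 1 + xsym F i 3) =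
  \sum_(q < n.+1) \sum_(r < n.+1 | (q + r == n)%N)
    scal n (phi r) * ch (nseq q 3 ++ nseq r 1).

Definition psi_spin_expansion (F : fieldType) (n : nat)
    (ch : seq int -> xfield F n) (a12 a32 : F) (psi : nat -> nat -> F) : Prop :=
  \prod_(i < n)
    (scal n a12 * xsym F i 1 + scal n a32 * xsym F i 3 + xsym F i 5) =
  \sum_(p < n.+1) \sum_(q < n.+1) \sum_(r < n.+1 | (p + q + r == n)%N)
    scal n (psi q r) * ch (nseq p 5 ++ nseq q 3 ++ nseq r 1).

(* Main.v *)
Require Import Defs.
From HB Require Import structures.
From mathcomp Require Import all_boot all_order all_fingroup all_algebra.
From mathcomp Require Import zify ring.

Set Implicit Arguments.
Unset Strict Implicit.
Unset Printing Implicit Defensive.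

Import GRing.Theory.

Local Open Scope ring_scope.

(** Write t_i for the square root of x_i, and let [alt eps mu] be the
determinant of the matrix of entries t_i^(mu_j) + eps t_i^(- mu_j).  Up to
normalization every character involved is a quotient of two such alternants,
with eps = -1 for Sp(2n) and SO(2n+1), and with eps = 1 for the spin
characters of O(2n) ([alternant_BC], [alternant_D_double]).

The products on the spin side carry a factor
D = prod_i (t_i + t_i^(-1)), because
  (t + t^-1) (a + b (t^2 + t^-2) + c (t^4 + t^-4))
  = (a + b) (t + t^-1) + (b + c) (t^3 + t^-3) + c (t^5 + t^-5);
this is where the change of parameters comes from ([xsym1_band]).  The same D
comes out of the spin characters, since multiplication by D turns the Weyl
denominator of SO(2n+1) into that of Sp(2n), and that of SO(2n) into the
alternant with eps = 1 at the rho of SO(2n+1) ([alt_step]):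
 - the SO(2n+1) character of weight lambda + 1/2 is D times the Sp(2n)
   character of weight lambda ([ch_SOodd_spin]);
 - the O(2n) character of weight lambda + 1/2 is D times the SO(2n+1)
   quotient of weight lambda in which eps = -1 has become eps = 1
   ([ch_O_spin_odd]).
After cancelling D, a spin expansion becomes an expansion in the characters
of Sp(2n), respectively in these modified SO(2n+1) quotients.

Multiply such an expansion by its denominator.  The coefficient of the
dominant monomial t^(lambda + rho) on the right is the coefficient attached
to lambda alone, as that monomial occurs in no other alternant of the sum; on
the left it is the determinant of the coefficients of single-variable Laurent
polynomials.  Hence every expansion coefficient is an explicit minor
[band_minor] of a banded matrix ([alt_expansion_coef]).  For SO(2n+1) and
Sp(2n) the two minors coincide ([SO_spin_coef]).  For O(2n) and SO(2n+1) they
are related by x -> - x, which on odd powers of t exchanges eps = 1 and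
eps = -1 up to signs attached to the rows and to the columns; those signs
multiply to (-1)^|lambda| ([band_minor_twist], [O_spin_coef]). *)

(** * Laurent polynomials in the square roots *)

Section Laurent.
Variables (F : fieldType) (n : nat).
Local Notation K := (xfield F n).
Implicit Types (i : 'I_n) (m d : int) (g h : seq (F * int)).

HB.instance Definition _ :=
  GRing.RMorphism.copy (@scal F n)
    ((@FracField.tofrac _) \o (@mpolyC n F)).

Lemma var_neq0 i : (FracField.tofrac ('X_i : {mpoly F[n]}) : K) != 0.
Proof. by rewrite tofrac_eq0 -msize_poly_eq0 msizeX. Qed.

Lemma xpowD i k m : xpow F i (k + m) = xpow F i k * xpow F i m.
Proof. exact: expfzDr (var_neq0 i). Qed.

Lemma xpow0 i : xpow F i 0 = 1.
Proof. by []. Qed.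

(** Multiplying by a large power of every t_i turns the Laurent monomials into
monomials of the polynomial ring, which embeds in its fraction field. *)
Lemma monomials_free (T : finType) (c : T -> F) (e : T -> 'I_n -> int)
    (m : 'I_n -> int) :
  \sum_x scal n (c x) * \prod_i xpow F i (e x i) = 0 ->
  \sum_x c x * \prod_i (e x i == m i)%:R = 0.
Proof.
move=> sum0.
pose D := (\sum_x \sum_i `|e x i| + \sum_i `|m i|)%N.
(* D bounds all exponents, so the absolute value in sh loses nothing. *)
pose sh (u : 'I_n -> int) : 'X_{1.. n} :=
  [multinom `|(u i + D%:Z)%R|%N | i < n].
have eD x i : (`|e x i| <= D)%N.
  rewrite /D (bigD1 x) //= (bigD1 i) //=; lia.
have mD i : (`|m i| <= D)%N.
  rewrite /D [X in (_ + X)%N](bigD1 i) //=; lia.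
have shE x : \prod_i xpow F i (e x i) * \prod_i xpow F i D =
    FracField.tofrac ('X_[sh (e x)] : {mpoly F[n]}).
  rewrite -big_split /= mpolyXE_id rmorph_prod /=; apply: eq_bigr => i _.
  rewrite -xpowD /xpow mnmE rmorphXn /= exprnP; congr (_ ^ _).
  by have := eD x i; lia.
have : \sum_x c x *: 'X_[sh (e x)] = 0 :> {mpoly F[n]}.
  apply/eqP; rewrite -tofrac_eq0 rmorph_sum /=; apply/eqP.
  have := congr1 ( *%R^~ (\prod_i xpow F i D)) sum0.
  rewrite /= mul0r mulr_suml => sum0D.
  by rewrite -[RHS]sum0D; apply: eq_bigr => x _; rewrite -mulrA shE -mul_mpolyC rmorphM.
move=> /(congr1 (fun p => p@_(sh m))); rewrite mcoeff0 linear_sum /= => coef0.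
rewrite -[RHS]coef0.
apply: eq_bigr => x _; rewrite mcoeffZ mcoeffX; congr (_ * _).
have [/mnmP Em|] := eqVneq (sh (e x)) (sh m).
  rewrite big1 // => i _; move: (Em i) (eD x i) (mD i); rewrite !mnmE => *.
  by rewrite (_ : e x i = m i) ?eqxx //; lia.
move=> /eqP neq; have [i /negPf ne_i|eq_all] := pickP (fun i => e x i != m i).
  by rewrite (bigD1 i) //= ne_i mul0r.
case: neq; apply/mnmP => i; rewrite !mnmE.
by move/negbFE/eqP: (eq_all i) => ->.
Qed.

(** A Laurent polynomial in one variable is a list of pairs (coefficient,
exponent), possibly with repeated exponents: this makes the coefficients
computable, which they are not for a bare element of the fraction field. *)
Definition laurent i g : K := \sum_(p <- g) scal n p.1 * xpow F i p.2.
Definition lcoef g m : F := \sum_(p <- g) p.1 * (p.2 == m)%:R.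
Definition lscale (a : F) d g := [seq (a * p.1, p.2 + d) | p <- g].

Lemma laurent_cat i g h : laurent i (g ++ h) = laurent i g + laurent i h.
Proof. exact: big_cat. Qed.

Lemma lcoef_cat g h m : lcoef (g ++ h) m = lcoef g m + lcoef h m.
Proof. exact: big_cat. Qed.

Lemma laurent_scale i a d g :
  laurent i (lscale a d g) = scal n a * xpow F i d * laurent i g.
Proof.
rewrite /laurent big_map mulr_sumr; apply: eq_bigr => p _ /=.
by rewrite rmorphM xpowD /=; ring.
Qed.

Lemma lcoef_scale a d g m : lcoef (lscale a d g) m = a * lcoef g (m - d).
Proof.
rewrite /lcoef big_map mulr_sumr; apply: eq_bigr => p _ /=.
by rewrite mulrA -[in RHS](inj_eq (addIr d)) subrK.
Qed.

(** Lists of different lengths are summed over one common index type, so that a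
product of such sums can be distributed. *)
Lemma big_nth_pad (V : nmodType) (T : Type) (x0 : T) (f : T -> V) (s : seq T) M :
  f x0 = 0 -> (size s <= M)%N ->
  \sum_(x <- s) f x = \sum_(k < M) f (nth x0 s k).
Proof.
move=> f0 leM; rewrite (big_nth x0) big_mkord.
rewrite (big_ord_widen _ (fun k => f (nth x0 s k)) leM).
rewrite big_mkcond; apply: eq_bigr => k _; case: ltnP => // le.
by rewrite nth_default.
Qed.

(** The coefficient of a monomial in a product of Laurent polynomials in
separate variables is the product of the coefficients. *)
Lemma laurent_prod_coef (J : finType) (c : J -> F)
    (g : J -> 'I_n -> seq (F * int)) (m : 'I_n -> int) :
  \sum_j scal n (c j) * \prod_i laurent i (g j i) = 0 ->
  \sum_j c j * \prod_i lcoef (g j i) (m i) = 0.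
Proof.
pose M := (\sum_j \sum_i size (g j i))%N.
have leM j i : (size (g j i) <= M)%N.
  by rewrite /M (bigD1 j) //= (bigD1 i) //=; lia.
pose p j i (k : 'I_M) := nth (0, 0) (g j i) k.
have evE j i : laurent i (g j i) =
    \sum_k scal n (p j i k).1 * xpow F i (p j i k).2.
  by apply: big_nth_pad => //=; rewrite rmorph0 mul0r.
have coE j i : lcoef (g j i) (m i) =
    \sum_k (p j i k).1 * ((p j i k).2 == m i)%:R.
  by apply: (big_nth_pad (f := fun q => q.1 * (q.2 == m i)%:R)) => //=; rewrite mul0r.
pose C (x : J * {ffun 'I_n -> 'I_M}) := c x.1 * \prod_i (p x.1 i (x.2 i)).1.
pose E (x : J * {ffun 'I_n -> 'I_M}) i := (p x.1 i (x.2 i)).2.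
move=> sum0; have := @monomials_free _ C E m.
rewrite -(pair_bigA _ (fun j f => scal n (C (j, f)) * \prod_i xpow F i (E (j, f) i))) /=.
rewrite -(pair_bigA _ (fun j f => C (j, f) * \prod_i (E (j, f) i == m i)%:R)) /=.
move=> free; rewrite -[RHS]free; last first.
  rewrite -[RHS]sum0; apply: eq_bigr => j _.
  under [in RHS]eq_bigr => i _ do rewrite evE.
  rewrite bigA_distr_bigA mulr_sumr; apply: eq_bigr => f _.
  by rewrite /C rmorphM /= rmorph_prod -mulrA -big_split.
apply: eq_bigr => j _.
under eq_bigr => i _ do rewrite coE.
rewrite bigA_distr_bigA mulr_sumr; apply: eq_bigr => f _.
by rewrite /C -mulrA -big_split.
Qed.

Lemma laurent_det_coef (J : finType) (c : J -> F)
    (g : J -> 'I_n -> seq (F * int)) (m : 'I_n -> int) :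
  \sum_j scal n (c j) * \det (\matrix_(i, k) laurent i (g j k)) = 0 ->
  \sum_j c j * \det (\matrix_(i, k) lcoef (g j k) (m i)) = 0.
Proof.
pose C (x : J * 'S_n) := c x.1 * (-1) ^+ x.2.
pose G (x : J * 'S_n) i := g x.1 (x.2 i).
move=> sum0; have := @laurent_prod_coef _ C G m.
rewrite -(pair_bigA _ (fun j s => scal n (C (j, s)) * \prod_i laurent i (G (j, s) i))) /=.
rewrite -(pair_bigA _ (fun j s => C (j, s) * \prod_i lcoef (G (j, s) i) (m i))) /=.
move=> coef; rewrite -[RHS]coef.
  apply: eq_bigr => j _; rewrite mulr_sumr; apply: eq_bigr => s _.
  by rewrite -mulrA; under eq_bigr => i _ do rewrite mxE.
rewrite -[RHS]sum0; apply: eq_bigr => j _; rewrite mulr_sumr.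
apply: eq_bigr => s _; rewrite /C rmorphM rmorph_sign /= -mulrA.
by under [in RHS]eq_bigr => i _ do rewrite mxE.
Qed.

End Laurent.

(** * Alternants *)

Section Alternants.
Variables (F : fieldType) (n : nat).
Local Notation K := (xfield F n).
Implicit Types (i : 'I_n) (m : int).

Definition signed_pair (eps : F) (k : int) : seq (F * int) :=
  [:: (1, k); (eps, - k)].

Definition alt (eps : F) (mu : 'I_n -> int) : K :=
  \det (\matrix_(i, j) laurent i (signed_pair eps (mu j))).

Lemma laurent_pair i eps m :
  laurent i (signed_pair eps m) = xpow F i m + scal n eps * xpow F i (- m).
Proof. by rewrite /laurent !big_cons big_nil addr0 /= rmorph1 mul1r. Qed.

Lemma eq_alt eps mu mu' : mu =1 mu' -> alt eps mu = alt eps mu'.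
Proof. by move=> E; congr (\det _); apply/matrixP => i j; rewrite !mxE E. Qed.

(** Expanding each factor t^m + eps t^(-m) as a sum over a sign turns the
Leibniz formula into a sum over signed permutations. *)
Lemma altE eps mu :
  alt eps mu = \sum_(s : 'S_n) \sum_(e : {ffun 'I_n -> bool})
    (-1) ^+ s * (\prod_(i < n) scal n eps ^+ e i) *
    \prod_(i < n) xpow F i ((-1) ^+ e i * mu (s i)).
Proof.
apply: eq_bigr => s _.
pose f i (b : bool) := scal n eps ^+ b * xpow F i ((-1) ^+ b * mu (s i)).
have E i : (\matrix_(i, j) laurent i (signed_pair eps (mu j))) i (s i) =
    \sum_b f i b.
  by rewrite mxE laurent_pair big_bool /f /= expr0 expr1 !mul1r mulN1r addrC.
under eq_bigr => i _ do rewrite E.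
rewrite bigA_distr_bigA mulr_sumr; apply: eq_bigr => e _.
by rewrite big_split mulrA.
Qed.

Lemma alternant_BC mu : alternant F (@signs_BC n) mu = alt (-1) mu.
Proof.
rewrite altE; apply: eq_bigr => s _; apply: eq_bigr => e _.
by rewrite rmorphN rmorph1.
Qed.

(** Sign changes are weighted by 1 in the first alternant and by their
parity sign in the second, so only the even ones survive. *)
Lemma alternant_D_double mu :
  2 * alternant F (@signs_D n) mu = alt 1 mu + alt (-1) mu.
Proof.
rewrite !altE -big_split mulr_sumr; apply: eq_bigr => s _ /=.
rewrite -big_split mulr_sumr [LHS]big_mkcond; apply: eq_bigr => e _ /=.
rewrite rmorphN rmorph1 -mulrDl -mulrDr.
have -> : \prod_(i < n) 1 ^+ e i = 1 :> K by rewrite big1 // => i _; rewrite expr1n.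
have -> : \prod_(i < n) (-1) ^+ e i = (-1) ^+ odd #|[set i | e i]| :> K.
  rewrite -expr_sum signr_odd; congr (_ ^+ _).
  by rewrite -sum1_card [RHS]big_mkcond; apply: eq_bigr => i _; rewrite inE; case: (e i).
by rewrite /signs_D /=; case: odd;
  rewrite /= ?subrr ?mulr0 ?mul0r // mulr1 mulrA [2 * _]mulrC.
Qed.

Lemma det_scale (R : comPzRingType) (A : 'M[R]_n) (d d' : 'I_n -> R) :
  \det (\matrix_(i, j) (d i * A i j * d' j)) =
  (\prod_i d i) * \det A * \prod_j d' j.
Proof.
have -> : \matrix_(i, j) (d i * A i j * d' j) =
    diag_mx (\row_i d i) *m A *m diag_mx (\row_j d' j).
  by rewrite mul_mx_diag mul_diag_mx; apply/matrixP => i j; rewrite !mxE.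
rewrite !det_mulmx !det_diag.
by congr (_ * _ * _); apply: eq_bigr => j _; rewrite mxE.
Qed.

Lemma det_scale_rows (R : comPzRingType) (A : 'M[R]_n) (d : 'I_n -> R) :
  \det (\matrix_(i, j) (d i * A i j)) = (\prod_i d i) * \det A.
Proof.
have prod1 : \prod_(j < n) (1 : R) = 1 by rewrite big1.
rewrite -[RHS]mulr1 -[X in _ = _ * X]prod1 -det_scale; congr (\det _).
by apply/matrixP => i j; rewrite !mxE mulr1.
Qed.

Lemma alt_neg eps j0 mu mu' : eps * eps = 1 ->
  (forall j, mu' j = if j == j0 then - mu j else mu j) ->
  alt eps mu' = scal n eps * alt eps mu.
Proof.
move=> epsK mu'E; pose d j : K := if j == j0 then scal n eps else 1.
have -> : scal n eps * alt eps mu = (\prod_(i < n) 1) * alt eps mu * \prod_j d j.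
  rewrite big1 // mul1r mulrC; congr (_ * _).
  by rewrite (bigD1 j0) //= /d eqxx big1 ?mulr1 // => j /negPf ->.
rewrite -det_scale; congr (\det _); apply/matrixP => i j.
rewrite !mxE !laurent_pair mu'E mul1r /d; case: eqP; rewrite ?mulr1 // opprK => _.
by rewrite mulrDl mulrAC -rmorphM epsK rmorph1 /=; ring.
Qed.

(** (t + t^-1) (t^m + eps t^(-m)) is the sum of the same expressions at
m + 1 and at m - 1.  As the entries of rho decrease by 2, column j on the
left is the sum of columns j and j + 1 on the right, and the last column
has to fold back onto itself, with a factor delta. *)
Lemma alt_step eps delta (rho rho' : 'I_n -> int) (n_gt0 : (0 < n)%N) :
  (forall j, rho' j = rho j + 1) ->
  (forall j k : 'I_n, k = j.+1 :> nat -> rho k = rho j - 2) ->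
  (forall i j : 'I_n, j.+1 = n -> laurent i (signed_pair eps (rho j - 1)) =
     scal n delta * laurent i (signed_pair eps (rho' j))) ->
  \prod_i xsym F i 1 * alt eps rho = scal n (1 + delta) * alt eps rho'.
Proof.
move=> rho'E rhoS rho_last.
have lt_last : (n.-1 < n)%N by rewrite prednK.
pose last_j := Ordinal lt_last.
pose U : 'M[K]_n := \matrix_(k, j) (if k == j then
   (if j.+1 == n then scal n (1 + delta) else 1) else (k == j.+1 :> nat)%:R).
have detU : \det U = scal n (1 + delta).
  rewrite det_trig.
    rewrite (bigD1 last_j) //= mxE eqxx /= prednK // eqxx big1 ?mulr1 // => j.
    rewrite mxE eqxx -val_eqE /=; case: (j.+1 =P n) => //; lia.
  apply/is_trig_mxP => k j lt_kj.
  by rewrite mxE -val_eqE /= !ltn_eqF // ltnW.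
rewrite -detU -det_scale_rows [RHS]mulrC -det_mulmx; congr (\det _).
apply/matrixP => i j; rewrite !mxE (bigD1 j) //= !mxE eqxx.
have entryE : xsym F i 1 * laurent i (signed_pair eps (rho j)) =
    laurent i (signed_pair eps (rho' j)) +
    laurent i (signed_pair eps (rho j - 1)).
  rewrite !laurent_pair rho'E /xsym !opprD !xpowD opprK; ring.
rewrite entryE; case: eqP => [jn | /eqP jn].
  rewrite rho_last // big1 ?addr0 => [|k kj].
    by rewrite rmorphD rmorph1 /=; ring.
  rewrite !mxE (negPf kj); case: eqP => [kj1|_]; last by rewrite mulr0.
  by move: (ltn_ord k); rewrite kj1 jn ltnn.
have ltj : (j.+1 < n)%N by rewrite ltn_neqAle jn ltn_ord.
rewrite mulr1; congr (_ + _).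
rewrite (bigD1 (Ordinal ltj)) /=; last by rewrite -val_eqE /= gtn_eqF.
rewrite !mxE -val_eqE /= gtn_eqF // eqxx mulr1.
rewrite big1 ?addr0 => [|k /andP[kj kj1]].
  by rewrite rho'E (rhoS j (Ordinal ltj)) //; congr (laurent i (signed_pair _ _)); ring.
rewrite !mxE (negPf kj); case: eqP => [E|_]; last by rewrite mulr0.
by case/eqP: kj1; apply: val_inj.
Qed.

End Alternants.

(** * Expansion coefficients as minors *)

Section Minors.
Variables (F : fieldType) (n : nat).
Local Notation K := (xfield F n).
Implicit Types (i : 'I_n).

Definition strictly_dominant (mu : 'I_n -> int) :=
  (forall i, 0 < mu i) /\ (forall i j : 'I_n, (i < j)%N -> mu j < mu i).

(** A permutation matching the values of two decreasing sequences forces the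
sequences to be equal. *)
Lemma det_incidence (R : comNzRingType) (u v : 'I_n -> int) :
  strictly_dominant u -> strictly_dominant v ->
  \det (\matrix_(i, j) (v j == u i)%:R : 'M[R]_n) = [forall i, u i == v i]%:R.
Proof.
move=> [_ u_decr] [_ v_decr].
have sortedP w : (forall i j : 'I_n, (i < j)%N -> w j < w i :> int) ->
    sorted (fun x y : int => y < x) (codom w).
  move=> w_decr; rewrite /codom /image_mem sorted_map.
  have : sorted ltn (map val (enum 'I_n)) by rewrite val_enum_ord iota_ltn_sorted.
  rewrite sorted_map; apply: sub_sorted => i j; exact: w_decr.
have [/forallP uv | /forallP nuv] := boolP [forall i, u i == v i].
  rewrite (_ : \matrix_(_, _) _ = 1%:M) ?det1 //; apply/matrixP => i j.
  rewrite !mxE (eqP (uv i)); congr (nat_of_bool _)%:R.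
  apply/eqP/eqP => [|-> //] vij; apply: val_inj.
  by case: (ltngtP i j) => // /v_decr; rewrite vij Order.POrderTheory.ltxx.
apply: big1 => s _.
have [i /negPf ne_i | all_eq] := pickP (fun i => v (s i) != u i).
  by rewrite (bigD1 i) //= mxE ne_i mul0r mulr0.
have uE i : u i = v (s i) by apply/esym/eqP; exact: negbFE (all_eq i).
case: nuv => i; suff /eq_in_map E : codom u = codom v by rewrite E ?mem_enum.
apply: (irr_sorted_eq (leT := fun x y : int => y < x)); try exact: sortedP.
- by move=> x y z /=; lia.
- by move=> x /=; lia.
move=> x; apply/codomP/codomP => -[j ->]; first by exists (s j).
by exists (s^-1%g j); rewrite uE permKV.
Qed.

(** Multiplication by this Laurent polynomial is a banded operator on powers
of x_i; it is the common form of the factors of all the products, with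
(b, c) = (1, 0) for the shorter expansions and c = 1 for the longer ones. *)
Definition band (a b c : F) i : K :=
  scal n a + scal n b * xsym F i 2 + scal n c * xsym F i 4.

Definition band_mul (a b c : F) (g : seq (F * int)) :=
  lscale a 0 g ++ (lscale b 2 g ++ lscale b (- 2) g) ++
  (lscale c 4 g ++ lscale c (- 4) g).

Lemma laurent_band_mul i a b c g :
  laurent i (band_mul a b c g) = band a b c i * laurent i g.
Proof. by rewrite !laurent_cat !laurent_scale xpow0 /band /xsym; ring. Qed.

Lemma lcoef_band_mul a b c g m :
  lcoef (band_mul a b c g) m =
  a * lcoef g m + b * (lcoef g (m - 2) + lcoef g (m + 2)) +
  c * (lcoef g (m - 4) + lcoef g (m + 4)).
Proof. by rewrite !lcoef_cat !lcoef_scale subr0 !opprK; ring. Qed.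

Lemma lcoef_pair (eps : F) (k m : int) :
  lcoef (signed_pair eps k) m = (k == m)%:R + eps * (- k == m)%:R.
Proof. by rewrite /lcoef !big_cons big_nil addr0 mul1r. Qed.

(** Only positive exponents are read off, so the terms of negative exponent
do not contribute. *)
Lemma det_lcoef_pair (eps : F) (u v : 'I_n -> int) :
  strictly_dominant u -> strictly_dominant v ->
  \det (\matrix_(i, j) lcoef (signed_pair eps (v j)) (u i)) =
  [forall i, u i == v i]%:R.
Proof.
move=> du dv; rewrite -det_incidence //; congr (\det _).
apply/matrixP => i j; rewrite !mxE lcoef_pair.
have [u_gt0 v_gt0] := (du.1 i, dv.1 j).
by rewrite [X in _ + _ * X](_ : _ = 0) ?mulr0 ?addr0 //; case: eqP => //; lia.
Qed.

(** The coefficient of t^mu in the product of all the [band a b c i] with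
[alt eps rho]; a minor of the matrix of multiplication by [band a b c]. *)
Definition band_minor (eps a b c : F) (rho mu : 'I_n -> int) : F :=
  \det (\matrix_(i, j) lcoef (band_mul a b c (signed_pair eps (rho j))) (mu i)).

(** The coefficient of the monomial t^(mu j) is read off on both sides; on the
right it comes from the alternant of mu j only, since distinct strictly
dominant exponents lie in distinct orbits of signed permutations. *)
Theorem alt_expansion_coef (eps a b c : F) (rho : 'I_n -> int) (J : finType)
    (P : pred J) (x : J -> F) (mu : J -> 'I_n -> int) :
  (forall j, P j -> strictly_dominant (mu j)) ->
  (forall j k, P j -> P k -> mu j =1 mu k -> j = k) ->
  \prod_i band a b c i * alt eps rho =
    \sum_(j | P j) scal n (x j) * alt eps (mu j) ->
  forall j, P j -> x j = band_minor eps a b c rho (mu j).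
Proof.
move=> dom inj expn j0 Pj0.
(* The left-hand side is the single term indexed by unit. *)
pose C (y : unit + J) : F :=
  if y is inr j then if P j then - x j else 0 else 1.
pose g (y : unit + J) (k : 'I_n) : seq (F * int) :=
  if y is inr j then signed_pair eps (mu j k)
  else band_mul a b c (signed_pair eps (rho k)).
have bandE : \det (\matrix_(i, k) laurent i (g (inl tt) k)) =
    \prod_i band a b c i * alt eps rho.
  rewrite -det_scale_rows; congr (\det _); apply/matrixP => i k.
  by rewrite !mxE laurent_band_mul.
have := @laurent_det_coef _ _ _ C g (mu j0).
rewrite !big_sumType /= !(big_pred1 tt) /=; try by case.
have sum0 : \prod_i band a b c i * alt eps rho +
    \sum_j scal n (if P j then - x j else 0) * alt eps (mu j) = 0.
  rewrite expn big_mkcond -big_split big1 // => j _ /=.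
  by case: (P j); rewrite ?rmorphN ?mulNr ?subrr // rmorph0 mul0r addr0.
rewrite bandE rmorph1 !mul1r => /(_ sum0).
rewrite (bigD1 j0) //= Pj0 det_lcoef_pair; try exact: dom.
rewrite (_ : [forall i, _] = true); last by apply/forallP => i.
rewrite mulr1 big1 ?addr0 => [/eqP | j j_neq]; first by rewrite subr_eq0 => /eqP.
case: (boolP (P j)) => [Pj | _]; last by rewrite mul0r.
rewrite det_lcoef_pair; try exact: dom.
case: forallP => [E | _]; last by rewrite mulr0.
by case/eqP: j_neq; apply: inj => // i; rewrite -(eqP (E i)).
Qed.

(** If the alternant vanished, 1 and 0 would both be valid coefficients of it,
although coefficients are determined by the expansion. *)
Corollary alt_neq0 (eps : F) (mu : 'I_n -> int) :
  strictly_dominant mu -> alt eps mu != 0.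
Proof.
move=> dom; apply/eqP => alt0.
have coef (x : F) : x = band_minor eps 1 0 0 mu mu.
  have expn : \prod_i band 1 0 0 i * alt eps mu =
      \sum_(j : unit | predT j) scal n x * alt eps mu.
    by rewrite alt0 mulr0 big1 // => j _; rewrite mulr0.
  by apply: (alt_expansion_coef _ _ expn (j := tt)) => // - [] [].
by have /eqP := etrans (coef 1) (esym (coef 0)); rewrite oner_eq0.
Qed.

End Minors.

(** * Characters as quotients of alternants *)

Section Characters.
Variables (F : fieldType) (n : nat).
Local Notation K := (xfield F n).
Implicit Types (i : 'I_n) (p : seq nat).

(** In doubled coordinates this is the partition p itself, and [odd_weight p]
is p shifted by 1/2. *)
Definition even_weight p : seq int := [seq x.*2%:Z | x <- p].
Definition odd_weight p : seq int := [seq x.*2.+1%:Z | x <- p].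

Definition shifted (lambda : seq int) (rho : 'I_n -> int) i : int :=
  nth 0 lambda i + rho i.

Definition is_partition p := (size p == n) && sorted geq p.

Lemma nth_even_weight p i :
  is_partition p -> nth 0 (even_weight p) i = (nth 0%N p i).*2%:Z.
Proof. by case/andP=> /eqP sz _; rewrite (nth_map 0%N) // sz. Qed.

Lemma nth_odd_weight p i : is_partition p ->
  nth 0 (odd_weight p) i = nth 0 (even_weight p) i + 1.
Proof.
move=> part; rewrite nth_even_weight //; case/andP: part => /eqP sz _.
by rewrite (nth_map 0%N) ?sz //; lia.
Qed.

Lemma nth_partition p (i j : 'I_n) : is_partition p -> (i < j)%N ->
  (nth 0%N p j <= nth 0%N p i)%N.
Proof.
case/andP=> /eqP sz srt lt_ij.
have geq_trans : transitive geq by move=> x y z /= xy yz; apply: leq_trans yz xy.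
by apply: (sorted_leq_nth geq_trans leqnn 0%N srt (i : nat) (j : nat));
  rewrite ?inE ?sz // ltnW.
Qed.

Lemma dominant_SOodd p : is_partition p ->
  strictly_dominant (shifted (even_weight p) (@rho_SOodd n)).
Proof.
move=> part; split=> [i | i j lt_ij]; rewrite /shifted !nth_even_weight // /rho_SOodd.
  by have := ltn_ord i; lia.
by have := nth_partition part lt_ij; lia.
Qed.

Lemma dominant_Sp p : is_partition p ->
  strictly_dominant (shifted (even_weight p) (@rho_Sp n)).
Proof.
move=> part; split=> [i | i j lt_ij]; rewrite /shifted !nth_even_weight // /rho_Sp.
  by have := ltn_ord i; lia.
by have := nth_partition part lt_ij; lia.
Qed.

Lemma shifted_inj p q rho : is_partition p -> is_partition q ->
  shifted (even_weight p) rho =1 shifted (even_weight q) rho -> p = q.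
Proof.
move=> pp pq E; have [/andP[/eqP szp _] /andP[/eqP szq _]] := (pp, pq).
apply: (@eq_from_nth _ 0%N) => [|k]; first by rewrite szp.
rewrite szp => ltk; have := E (Ordinal ltk).
by rewrite /shifted !nth_even_weight //=; lia.
Qed.

Lemma alt_rho_SOodd_neq0 eps : alt eps (@rho_SOodd n) != 0 :> K.
Proof.
apply: alt_neq0; split=> [i | i j]; rewrite /rho_SOodd; first by have := ltn_ord i; lia.
by lia.
Qed.

Lemma alt_rho_Sp_neq0 eps : alt eps (@rho_Sp n) != 0 :> K.
Proof.
apply: alt_neq0; split=> [i | i j]; rewrite /rho_Sp; first by have := ltn_ord i; lia.
by lia.
Qed.

Hypothesis n_gt0 : (0 < n)%N.

(** The last entry of rho is 1, and t^0 - t^0 = 0: the last column does not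
fold back. *)
Lemma alt_rho_Sp : \prod_(i < n) xsym F i 1 * alt (-1) (@rho_SOodd n) =
  alt (-1) (@rho_Sp n).
Proof.
rewrite (alt_step (delta := 0) (rho' := @rho_Sp n) n_gt0).
- by rewrite addr0 rmorph1 mul1r.
- by move=> j; rewrite /rho_Sp /rho_SOodd; lia.
- by move=> j k kj; rewrite /rho_SOodd; lia.
move=> i j jn; have -> : rho_SOodd j - 1 = 0 by rewrite /rho_SOodd; lia.
by rewrite !laurent_pair oppr0 xpow0 rmorphN rmorph1 rmorph0 mul0r mulr1 subrr.
Qed.

(** The last entry of rho is 0, and t^(-1) + t is the last column itself:
it is counted twice. *)
Lemma alt_rho_SOeven : \prod_(i < n) xsym F i 1 * alt 1 (@rho_SOeven n) =
  2 * alt 1 (@rho_SOodd n).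
Proof.
rewrite (alt_step (delta := 1) (rho' := @rho_SOodd n) n_gt0).
- by rewrite rmorphD rmorph1.
- by move=> j; rewrite /rho_SOeven /rho_SOodd; lia.
- by move=> j k kj; rewrite /rho_SOeven; lia.
move=> i j jn.
have -> : rho_SOeven j - 1 = - 1 by rewrite /rho_SOeven; lia.
have -> : rho_SOodd j = 1 by rewrite /rho_SOodd; lia.
by rewrite !laurent_pair rmorph1 !mul1r opprK addrC.
Qed.

Lemma prod_xsym1_neq0 : \prod_(i < n) xsym F i 1 != 0.
Proof.
have := alt_rho_Sp_neq0 (-1); rewrite -alt_rho_Sp.
by apply: contraNneq => ->; rewrite mul0r.
Qed.

Lemma ch_SpE lambda :
  ch_Sp F n lambda = alt (-1) (shifted lambda (@rho_Sp n)) / alt (-1) (@rho_Sp n).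
Proof. by rewrite /ch_Sp /weyl_char !alternant_BC. Qed.

Lemma ch_SOoddE lambda : ch_SOodd F n lambda =
  alt (-1) (shifted lambda (@rho_SOodd n)) / alt (-1) (@rho_SOodd n).
Proof. by rewrite /ch_SOodd /weyl_char !alternant_BC. Qed.

(** The rho of SO(2n+1) plus 1/2 is the rho of Sp(2n): the two characters
have the same numerator. *)
Lemma ch_SOodd_spin p : is_partition p ->
  ch_SOodd F n (odd_weight p) = \prod_i xsym F i 1 * ch_Sp F n (even_weight p).
Proof.
move=> part; rewrite ch_SOoddE ch_SpE -alt_rho_Sp.
rewrite (_ : alt _ (shifted (odd_weight p) _) =
             alt (-1) (shifted (even_weight p) (@rho_Sp n))); last first.
  apply: eq_alt => i; rewrite /shifted nth_odd_weight // /rho_Sp /rho_SOodd.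
  by lia.
by rewrite invfM mulrCA mulVKf // prod_xsym1_neq0.
Qed.

Hypothesis two_neq0 : (2 : F) != 0.

Lemma two_neq0K : (2 : K) != 0.
Proof. by have := fmorph_eq0 (@scal F n) 2; rewrite rmorph_nat (negPf two_neq0) => ->. Qed.

(** Negating the last component multiplies [alt eps] by eps, so adding the
two SO(2n) numerators leaves the alternant with eps = 1.  The denominator is
half of [alt 1 rho], because the other half is an alternant which the zero
last entry of rho makes equal to its opposite. *)
Lemma ch_O_spin_odd p : is_partition p ->
  @ch_O_spin F n (odd_weight p) = \prod_i xsym F i 1 *
   (alt 1 (shifted (even_weight p) (@rho_SOodd n)) / alt 1 (@rho_SOodd n)).
Proof.
move=> part.
have lt_last : (n.-1 < n)%N by rewrite prednK.
pose last_i := Ordinal lt_last.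
have rho_last : rho_SOeven last_i = 0 by rewrite /rho_SOeven /=; lia.
have rhoN i : rho_SOeven i = if i == last_i then - rho_SOeven i else rho_SOeven i.
  by case: eqP => // ->; rewrite rho_last.
have N1 : (-1) * (-1) = 1 :> F by rewrite mulrNN mulr1.
have den : 2 * alternant F (@signs_D n) (@rho_SOeven n) = alt 1 (@rho_SOeven n).
  rewrite alternant_D_double; have /eqP := alt_neg N1 rhoN.
  rewrite rmorphN rmorph1 mulN1r -addr_eq0 -mulr2n -mulr_natl mulf_eq0.
  by rewrite (negPf two_neq0K) /= => /eqP ->; rewrite addr0.
pose mu := shifted (odd_weight p) (@rho_SOeven n).
pose mu' := shifted (neg_last n (odd_weight p)) (@rho_SOeven n).
have muN i : mu' i = if i == last_i then - mu i else mu i.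
  rewrite /mu' /mu /shifted /neg_last nth_set_nth /= -val_eqE /=.
  case: eqP => [il|//]; rewrite (_ : rho_SOeven i = 0) ?addr0 ?il //.
  by rewrite -rho_last; congr rho_SOeven; apply: val_inj.
have num : alternant F (@signs_D n) mu + alternant F (@signs_D n) mu' = alt 1 mu.
  apply: (mulfI two_neq0K); rewrite mulrDr !alternant_D_double.
  rewrite (alt_neg (mulr1 1) muN) (alt_neg N1 muN) rmorphN rmorph1; ring.
have muE : alt 1 mu = alt 1 (shifted (even_weight p) (@rho_SOodd n)) :> K.
  apply: eq_alt => i; rewrite /mu /shifted nth_odd_weight // /rho_SOeven /rho_SOodd.
  by lia.
rewrite /ch_O_spin /ch_SOeven /weyl_char -mulrDl num muE.
have key : \prod_i xsym F i 1 * alternant F (@signs_D n) (@rho_SOeven n) =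
    alt 1 (@rho_SOodd n).
  by apply: (mulfI two_neq0K); rewrite mulrCA den alt_rho_SOeven.
by rewrite -key invfM mulrCA mulVKf // prod_xsym1_neq0.
Qed.

End Characters.

(** * Comparison of the minors *)

Section Comparison.
Variables (F : fieldType) (n : nat).
Local Notation K := (xfield F n).
Implicit Types (i : 'I_n) (p : seq nat).

Lemma laurent_times_sum (L : fieldType) (t a b c : L) : t != 0 ->
  (t + t^-1) * (a + b * (t ^+ 2 + t ^- 2) + c * (t ^+ 4 + t ^- 4)) =
  (a + b) * (t + t^-1) + (b + c) * (t ^+ 3 + t ^- 3) + c * (t ^+ 5 + t ^- 5).
Proof. by move=> t_neq0; field. Qed.

Lemma xsym1_band (a b c : F) i :
  xsym F i 1 * band a b c i =
  scal n (a + b) * xsym F i 1 + scal n (b + c) * xsym F i 3 +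
  scal n c * xsym F i 5.
Proof.
by rewrite /band !rmorphD; apply: laurent_times_sum (var_neq0 F i).
Qed.

Let chi (u : int) : F := (-1) ^ u.

Let chiD u v : chi (u + v) = chi u * chi v.
Proof. by rewrite /chi expfzDr // oppr_eq0 oner_eq0. Qed.

Let chiK u : chi u * chi u = 1.
Proof. by rewrite /chi -expfzMl mulrNN mulr1 exp1rz. Qed.

Let chiN1 : chi (- 1) = - 1.
Proof. by rewrite /chi exprN1 invrN1. Qed.

(** Give the exponent 2 u + 1 the sign (-1)^u: then opposite exponents have
opposite signs, so twisting by these signs exchanges t^m - t^(-m) and
t^m + t^(-m) for m odd, up to a global sign. *)
Lemma lcoef_pair_twist (u v : int) :
  lcoef (signed_pair (1 : F) (2 * v + 1)) (2 * u + 1) =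
  chi u * chi v * lcoef (signed_pair (- 1) (2 * v + 1)) (2 * u + 1).
Proof.
rewrite !lcoef_pair.
have -> : (2 * v + 1 == 2 * u + 1) = (v == u) by lia.
have -> : (- (2 * v + 1) == 2 * u + 1) = (u == - v - 1) by lia.
have [->|_] := eqVneq v u.
  have -> : (u == - u - 1) = false by lia.
  by rewrite chiK !mul1r !mulr0.
have [->|_] := eqVneq u (- v - 1); last by rewrite !mulr0 addr0 mulr0.
have -> : chi (- v - 1) * chi v = - 1 by rewrite -chiD addrAC addNr add0r.
by rewrite /= !add0r mulrA mulrNN !mulr1.
Qed.

(** Passing from x to - x negates the odd part b of the factor; the common
scalar s accounts for factors normalized with the opposite sign. *)
Lemma lcoef_band_twist (s a b c : F) (u v : int) :
  lcoef (band_mul (s * a) (- s * b) (s * c) (signed_pair 1 (2 * v + 1)))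
    (2 * u + 1) =
  s * chi u *
  lcoef (band_mul a b c (signed_pair (- 1) (2 * v + 1))) (2 * u + 1) * chi v.
Proof.
have twist d m : m = 2 * (u + d) + 1 ->
    lcoef (signed_pair (1 : F) (2 * v + 1)) m =
    chi d * (chi u * chi v * lcoef (signed_pair (- 1) (2 * v + 1)) m).
  by move=> ->; rewrite lcoef_pair_twist chiD !mulrA [chi u * _]mulrC.
have chi1 : chi 1 = - 1 by [].
have chi2 : chi 2 = 1 by rewrite (chiD 1 1) chiK.
have chiN2 : chi (- 2) = 1 by rewrite (chiD (- 1) (- 1)) chiK.
rewrite !lcoef_band_mul (twist 0 (2 * u + 1)); last by lia.
rewrite (twist (- 1) (2 * u + 1 - 2)); last by lia.
rewrite (twist 1 (2 * u + 1 + 2)); last by lia.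
rewrite (twist (- 2) (2 * u + 1 - 4)); last by lia.
rewrite (twist 2 (2 * u + 1 + 4)); last by lia.
rewrite chi1 chiN1 chi2 chiN2 (_ : chi 0 = 1) //.
move: (chi u) (chi v) (lcoef _ _) (lcoef _ _) (lcoef _ _) (lcoef _ _) (lcoef _ _).
by move=> *; ring.
Qed.

(** With the sign (-1)^u attached to the exponent 2 u + 1, row i contributes s
times the sign of (lambda + rho)_i and column j the sign of rho_j; together
they leave s^n and the parity of |lambda|. *)
Lemma band_minor_twist (s a b c : F) p : is_partition n p ->
  band_minor 1 (s * a) (- s * b) (s * c) (@rho_SOodd n)
    (shifted (even_weight p) (@rho_SOodd n)) =
  s ^+ n * (-1) ^+ sumn p *
  band_minor (- 1) a b c (@rho_SOodd n)
    (shifted (even_weight p) (@rho_SOodd n)).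
Proof.
move=> part.
pose v i : int := n%:Z - i%:Z - 1; pose u i : int := (nth 0%N p i)%:Z + v i.
have rhoE i : rho_SOodd i = 2 * v i + 1 by rewrite /rho_SOodd /v; lia.
have muE i : shifted (even_weight p) (@rho_SOodd n) i = 2 * u i + 1.
  by rewrite /shifted nth_even_weight // rhoE /u; lia.
transitivity ((\prod_i (s * chi (u i))) * band_minor (- 1) a b c (@rho_SOodd n)
    (shifted (even_weight p) (@rho_SOodd n)) * \prod_j chi (v j)).
  rewrite -det_scale; congr (\det _); apply/matrixP => i j.
  by rewrite !mxE muE rhoE lcoef_band_twist.
rewrite mulrAC -big_split; congr (_ * _) => /=.
have -> : sumn p = (\sum_(i < n) nth 0%N p i)%N.
  by case/andP: part => /eqP sz _; rewrite sumnE (big_nth 0%N) sz big_mkord.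
have -> : s ^+ n = \prod_(i < n) s by rewrite prodr_const card_ord.
rewrite expr_sum -big_split.
by apply: eq_bigr => i _; rewrite /= /u chiD -!mulrA chiK mulr1.
Qed.

Section Expansions.
Hypothesis n_gt0 : (0 < n)%N.
Variables (J : finType) (P : pred J) (part : J -> seq nat).
Hypothesis partP : forall j, P j -> is_partition n (part j).
Hypothesis part_inj : {in P &, injective part}.

Lemma ratio_expansion_coef (eps : F) (rho : 'I_n -> int) (ch : seq nat -> K)
    (a b c : F) (x : J -> F) :
  (forall p, is_partition n p -> strictly_dominant (shifted (even_weight p) rho)) ->
  alt eps rho != 0 :> K ->
  (forall p, ch p = alt eps (shifted (even_weight p) rho) / alt eps rho) ->
  \prod_(i < n) band a b c i = \sum_(j | P j) scal n (x j) * ch (part j) ->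
  forall j, P j ->
    x j = band_minor eps a b c rho (shifted (even_weight (part j)) rho).
Proof.
move=> dom alt_neq0 chE expn.
apply: (alt_expansion_coef (mu := fun j => shifted (even_weight (part j)) rho)) =>
  [j Pj|j k Pj Pk E|].
- exact/dom/partP.
- by apply: part_inj => //; exact: shifted_inj (partP Pj) (partP Pk) E.
rewrite expn mulr_suml; apply: eq_bigr => j _.
by rewrite chE -mulrA divfK.
Qed.

Lemma spin_factor_cancel (spin_ch ratio : seq nat -> K) (a b c : F) (x : J -> F) :
  (forall p, is_partition n p -> spin_ch p = \prod_i xsym F i 1 * ratio p) ->
  \prod_(i < n) (xsym F i 1 * band a b c i) =
    \sum_(j | P j) scal n (x j) * spin_ch (part j) ->
  \prod_(i < n) band a b c i = \sum_(j | P j) scal n (x j) * ratio (part j).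
Proof.
move=> spin_chE; rewrite big_split => expn.
apply: (mulfI (prod_xsym1_neq0 F n_gt0)); rewrite [LHS]expn mulr_sumr.
by apply: eq_bigr => j Pj; rewrite spin_chE ?partP // mulrCA.
Qed.

Theorem SO_spin_coef (a b c : F) (x y : J -> F) :
  \prod_(i < n) band a b c i =
    \sum_(j | P j) scal n (x j) * ch_Sp F n (even_weight (part j)) ->
  \prod_(i < n) (xsym F i 1 * band a b c i) =
    \sum_(j | P j) scal n (y j) * ch_SOodd F n (odd_weight (part j)) ->
  forall j, P j -> y j = x j.
Proof.
move=> expn_x expn_y j Pj.
have := spin_factor_cancel (ch_SOodd_spin F n_gt0) expn_y.
have coef := ratio_expansion_coef (@dominant_Sp n) (@alt_rho_Sp_neq0 F n (- 1))
  (fun p => @ch_SpE F n (even_weight p)).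
by move=> /coef -> //; rewrite (coef _ _ _ _ expn_x).
Qed.

Theorem O_spin_coef (s a b c a' b' c' : F) (x y : J -> F) : (2 : F) != 0 ->
  a' = s * a -> b' = - s * b -> c' = s * c ->
  \prod_(i < n) band a b c i =
    \sum_(j | P j) scal n (x j) * ch_SOodd F n (even_weight (part j)) ->
  \prod_(i < n) (xsym F i 1 * band a' b' c' i) =
    \sum_(j | P j) scal n (y j) * @ch_O_spin F n (odd_weight (part j)) ->
  forall j, P j -> y j = s ^+ n * (-1) ^+ sumn (part j) * x j.
Proof.
move=> two_neq0 -> -> -> expn_x expn_y j Pj.
have {}expn_y := spin_factor_cancel (ch_O_spin_odd n_gt0 two_neq0) expn_y.
have dom := @dominant_SOodd n; have neq0 := @alt_rho_SOodd_neq0 F n.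
rewrite (ratio_expansion_coef dom (neq0 (- 1))
  (fun p => @ch_SOoddE F n (even_weight p)) expn_x) //.
rewrite (ratio_expansion_coef dom (neq0 1) (fun=> erefl) expn_y) //.
exact/band_minor_twist/partP.
Qed.

End Expansions.
End Comparison.

(** * The weights with parts at most two *)

Section Reindexing.
Variables (F : fieldType) (n : nat).
Local Notation K := (xfield F n).
Local Notation I := 'I_n.+1.

Definition phi_index : pred (I * I) := fun j => (j.1 + j.2 == n)%N.
Definition phi_part (j : I * I) := nseq j.1 1%N ++ nseq j.2 0%N.

Definition psi_index : pred (I * (I * I)) := fun j => (j.1 + j.2.1 + j.2.2 == n)%N.
Definition psi_part (j : I * (I * I)) :=
  nseq j.1 2%N ++ nseq j.2.1 1%N ++ nseq j.2.2 0%N.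

Lemma phi_partP j : phi_index j -> is_partition n (phi_part j).
Proof.
rewrite /phi_index => jn; rewrite /is_partition size_cat !size_nseq jn.
apply/(sortedP 0%N) => k _ /=; rewrite !nth_cat !size_nseq !nth_nseq !if_same.
by do ![case: ifP => ?]; lia.
Qed.

Lemma psi_partP j : psi_index j -> is_partition n (psi_part j).
Proof.
rewrite /psi_index => jn; rewrite /is_partition !size_cat !size_nseq addnA jn.
apply/(sortedP 0%N) => k _ /=; rewrite !nth_cat !size_nseq !nth_nseq !if_same.
by do ![case: ifP => ?]; lia.
Qed.

Lemma phi_part_inj : {in phi_index &, injective phi_part}.
Proof.
move=> [q r] [q' r']; rewrite !unfold_in /phi_index /phi_part /= => qr qr'.
move=> /(congr1 (count_mem 1%N)); rewrite !count_cat !count_nseq /= => E.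
by congr (_, _); apply: val_inj => /=; lia.
Qed.

Lemma psi_part_inj : {in psi_index &, injective psi_part}.
Proof.
move=> [p [q r]] [p' [q' r']]; rewrite !unfold_in /psi_index /psi_part /= => pqr pqr' E.
have := congr1 (count_mem 1%N) E; rewrite !count_cat !count_nseq /= => E1.
have := congr1 (count_mem 2%N) E; rewrite !count_cat !count_nseq /= => E2.
by congr (_, (_, _)); apply: val_inj => /=; lia.
Qed.

Lemma phi_expansion_band (ch : seq int -> K) a0 phi : phi_expansion ch a0 phi ->
  \prod_(i < n) band a0 1 0 i =
  \sum_(j | phi_index j) scal n (phi j.2) * ch (even_weight (phi_part j)).
Proof.
rewrite /phi_expansion pair_big_dep /= => expn.
have -> : \prod_(i < n) band a0 1 0 i = \prod_(i < n) (scal n a0 + xsym F i 2).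
  by apply: eq_bigr => i _; rewrite /band rmorph1 mul1r rmorph0 mul0r addr0.
rewrite [LHS]expn; apply: eq_bigr => j _.
by rewrite /even_weight map_cat !map_nseq.
Qed.

Lemma psi_expansion_band (ch : seq int -> K) a0 a1 psi :
  psi_expansion ch a0 a1 psi ->
  \prod_(i < n) band a0 a1 1 i =
  \sum_(j | psi_index j) scal n (psi j.2.1 j.2.2) * ch (even_weight (psi_part j)).
Proof.
rewrite /psi_expansion; under [RHS]eq_bigr => p _ do rewrite pair_big_dep.
rewrite pair_big_dep /= => expn.
have -> : \prod_(i < n) band a0 a1 1 i =
    \prod_(i < n) (scal n a0 + scal n a1 * xsym F i 2 + xsym F i 4).
  by apply: eq_bigr => i _; rewrite /band rmorph1 mul1r.
rewrite [LHS]expn; apply: eq_bigr => j _.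
by rewrite /even_weight !map_cat !map_nseq.
Qed.

Lemma phi_spin_expansion_band (ch : seq int -> K) a12 phi :
  phi_spin_expansion ch a12 phi ->
  \prod_(i < n) (xsym F i 1 * band (a12 - 1) 1 0 i) =
  \sum_(j | phi_index j) scal n (phi j.2) * ch (odd_weight (phi_part j)).
Proof.
rewrite /phi_spin_expansion pair_big_dep /= => expn.
have -> : \prod_(i < n) (xsym F i 1 * band (a12 - 1) 1 0 i) =
    \prod_(i < n) (scal n a12 * xsym F i 1 + xsym F i 3).
  apply: eq_bigr => i _.
  by rewrite xsym1_band subrK addr0 rmorph1 mul1r rmorph0 mul0r addr0.
rewrite [LHS]expn; apply: eq_bigr => j _.
by rewrite /odd_weight map_cat !map_nseq.
Qed.

Lemma psi_spin_expansion_band (ch : seq int -> K) a12 a32 psi :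
  psi_spin_expansion ch a12 a32 psi ->
  \prod_(i < n) (xsym F i 1 * band (a12 - a32 + 1) (a32 - 1) 1 i) =
  \sum_(j | psi_index j) scal n (psi j.2.1 j.2.2) * ch (odd_weight (psi_part j)).
Proof.
rewrite /psi_spin_expansion; under [RHS]eq_bigr => p _ do rewrite pair_big_dep.
rewrite pair_big_dep /= => expn.
have -> : \prod_(i < n) (xsym F i 1 * band (a12 - a32 + 1) (a32 - 1) 1 i) =
    \prod_(i < n) (scal n a12 * xsym F i 1 + scal n a32 * xsym F i 3 + xsym F i 5).
  apply: eq_bigr => i _.
  by rewrite xsym1_band addrACA subrr addr0 !subrK rmorph1 mul1r.
rewrite [LHS]expn; apply: eq_bigr => j _.
by rewrite /odd_weight !map_cat !map_nseq.
Qed.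

End Reindexing.

Theorem mainTheorem12 (F : fieldType) (F_char0 : [pchar F] =i pred0)
    (n : nat) (n_gt0 : (0 < n)%N)
    (phi_Sp phi_SO phi_SO_spin phi_O_spin : F -> nat -> F)
    (psi_Sp psi_SO psi_SO_spin psi_O_spin : F -> F -> nat -> nat -> F)
    (phi_SpP : forall a0, phi_expansion (ch_Sp F n) a0 (phi_Sp a0))
    (phi_SOP : forall a0, phi_expansion (ch_SOodd F n) a0 (phi_SO a0))
    (psi_SpP : forall a0 a1, psi_expansion (ch_Sp F n) a0 a1 (psi_Sp a0 a1))
    (psi_SOP : forall a0 a1, psi_expansion (ch_SOodd F n) a0 a1 (psi_SO a0 a1))
    (phi_SO_spinP : forall a12,
      phi_spin_expansion (ch_SOodd F n) a12 (phi_SO_spin a12))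
    (phi_O_spinP : forall a12,
      phi_spin_expansion (@ch_O_spin F n) a12 (phi_O_spin a12))
    (psi_SO_spinP : forall a12 a32,
      psi_spin_expansion (ch_SOodd F n) a12 a32 (psi_SO_spin a12 a32))
    (psi_O_spinP : forall a12 a32,
      psi_spin_expansion (@ch_O_spin F n) a12 a32 (psi_O_spin a12 a32))
    (a12 a32 : F) :
  [/\ forall r : nat, (r <= n)%N ->
        phi_SO_spin a12 r = phi_Sp (a12 - 1) r,
      forall r : nat, (r <= n)%N ->
        phi_O_spin a12 r = (-1) ^+ r * phi_SO (- a12 + 1) r,
      forall q r : nat, (q + r <= n)%N ->
        psi_SO_spin a12 a32 q r = psi_Sp (a12 - a32 + 1) (a32 - 1) q r
    & forall q r : nat, (q + r <= n)%N ->
        psi_O_spin a12 a32 q r =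
        (-1) ^+ q * psi_SO (a12 - a32 + 1) (- a32 + 1) q r].
Proof.
have two_neq0 : (2 : F) != 0 by move/pcharf0P: F_char0 => ->.
have phi_coef r : (r <= n)%N -> exists2 j : 'I_n.+1 * 'I_n.+1,
    phi_index j & j.2 = r :> nat.
  move=> le_rn; exists (inord (n - r), inord r).
    by rewrite /phi_index /= !inordK; lia.
  by rewrite inordK.
have psi_coef q r : (q + r <= n)%N -> exists2 j : 'I_n.+1 * ('I_n.+1 * 'I_n.+1),
    psi_index j & j.2.1 = q :> nat /\ j.2.2 = r :> nat.
  move=> le_qrn; exists (inord (n - (q + r)), (inord q, inord r)).
    by rewrite /psi_index /= !inordK; lia.
  by rewrite /= !inordK; lia.
split=> [r /phi_coef[j Pj <-]|r /phi_coef[j Pj <-]|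
         q r /psi_coef[j Pj [<- <-]]|q r /psi_coef[j Pj [<- <-]]].
- apply: (SO_spin_coef n_gt0 (@phi_partP n) (@phi_part_inj n)
    (phi_expansion_band (phi_SpP (a12 - 1)))
    (phi_spin_expansion_band (phi_SO_spinP a12)) Pj).
- have expn_O := phi_spin_expansion_band (phi_O_spinP a12).
  have -> : (-1) ^+ j.2 = (-1) ^+ n * (-1) ^+ sumn (phi_part j) :> F.
    have jn : n = (j.1 + j.2)%N by exact/esym/eqP.
    rewrite sumn_cat !sumn_nseq mul1n mul0n addn0 [X in _ ^+ X * _]jn exprD mulrAC.
    by rewrite -expr2 sqrr_sign mul1r.
  apply: (O_spin_coef n_gt0 (@phi_partP n) (@phi_part_inj n) two_neq0 _ _ _
    (phi_expansion_band (phi_SOP (- a12 + 1))) expn_O Pj); ring.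
- apply: (SO_spin_coef n_gt0 (@psi_partP n) (@psi_part_inj n)
    (psi_expansion_band (psi_SpP _ _))
    (psi_spin_expansion_band (psi_SO_spinP a12 a32)) Pj).
have expn_O := psi_spin_expansion_band (psi_O_spinP a12 a32).
have -> : (-1) ^+ j.2.1 = 1 ^+ n * (-1) ^+ sumn (psi_part j) :> F.
  rewrite expr1n mul1r !sumn_cat !sumn_nseq mul1n mul0n addn0 exprD exprM.
  by rewrite sqrrN !expr1n mul1r.
by apply: (O_spin_coef n_gt0 (@psi_partP n) (@psi_part_inj n) two_neq0 _ _ _
  (psi_expansion_band (psi_SOP (a12 - a32 + 1) (- a32 + 1))) expn_O Pj); ring.
Qed.
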